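(* Let $L$ be a finite-dimensional Lie algebra over $\mathbb{F}$. Let $U_0(0)=0$, $U_{k+1}(0)=U(U_k(0))$ for $k\ge 0$, and let $m\ge 0$ be the integer such that $$0=U_0(0)\subsetneq U_1(0)\subsetneq\cdots\subsetneq U_m(0)$$ and $U_m(0)$ is an upper bounded ideal of $L$ (so that this chain is the upper central series of $L$). Then the smallest upper bounded ideal of $L$ is $U_m(0)$, the largest ideal in the upper central series of $L$.
   Context: $\mathbb{F}$ denotes either the field of real numbers or the field of complex numbers. For an ideal $I$ of $L$, define $U(I)=\{x\in L: [x,L]\subseteq I\}$, where $[x,L]=\{[x,y]:y\in L\}$; $U(I)$ is an ideal of $L$ with $I\subseteq U(I)\subseteq L$, called the upper extension of $I$. The ideal $I$ is called an upper bounded ideal of $L$ if $U(I)=I$. In particular $U_1(0)=U(0)$ is the center $Z(L)$. ''Smallest'' means contained in every upper bounded ideal of $L$. *)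

(* Defs.v *)
From HB Require Import structures.
From mathcomp Require Import all_boot all_order all_algebra.
From mathcomp Require Import boolp classical_sets reals complex.

Set Implicit Arguments.
Unset Strict Implicit.
Unset Printing Implicit Defensive.

Import GRing.Theory.

Local Open Scope classical_set_scope.
Local Open Scope ring_scope.

Variant ground_field := RealNumbers | ComplexNumbers.

Definition scalars (R : realType) (k : ground_field) : fieldType :=
  match k with
  | RealNumbers => R
  | ComplexNumbers => R[i]
  end.

HB.mixin Record Vector_isLieAlgebra (F : fieldType) L & Vector F L := {
  bracket : L -> L -> L;
  bracket_linearl : forall y, linear (bracket^~ y);
  bracket_linearr : forall x, linear (bracket x);
  bracketxx : forall x, bracket x x = 0;
  jacobi : forall x y z,
    bracket x (bracket y z) + bracket y (bracket z x)
      + bracket z (bracket x y) = 0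
}.

(* Finite-dimensionality is part of the underlying vectType structure. *)
#[short(type="lieAlgType")]
HB.structure Definition LieAlgebra (F : fieldType) :=
  { L of Vector F L & Vector_isLieAlgebra F L }.

Section UpperBoundedIdeals.
Variables (F : fieldType) (L : lieAlgType F).
Implicit Types (x y : L) (I J : set L).

(* By bracketC, one-sided ideals are two-sided. *)
Definition ideal I : Prop :=
  submod_closed [in I] /\ (forall x y, I x -> I (bracket x y)).

Definition upper_extension I : set L := [set x | range (bracket x) `<=` I].

Definition upper_bounded_ideal I : Prop := ideal I /\ upper_extension I = I.

Definition smallest_upper_bounded_ideal I : Prop :=
  upper_bounded_ideal I /\ forall J, upper_bounded_ideal J -> I `<=` J.

Definition upper_central_series (k : nat) : set L :=
  iter k upper_extension [set 0].

(* The m for which 0 = U_0(0) < ... < U_m(0) is strict and ends in an upper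
   bounded ideal; see upper_central_length_exists. *)
Definition is_upper_central_length (m : nat) : Prop :=
  (forall k, (k < m)%N ->
     upper_central_series k `<` upper_central_series k.+1) /\
  upper_bounded_ideal (upper_central_series m).

Lemma bracketC x y : bracket x y = - bracket y x.
Proof.
have addl u v w : bracket (u + v) w = bracket u w + bracket v w :> L.
  by have := bracket_linearl w 1 u v; rewrite !scale1r.
have addr u v w : bracket u (v + w) = bracket u v + bracket u w :> L.
  by have := bracket_linearr u 1 v w; rewrite !scale1r.
apply/eqP; rewrite -addr_eq0; have := bracketxx (x + y).
by rewrite addl !addr !bracketxx addr0 add0r => /eqP.
Qed.

Lemma ideal0 : ideal [set 0].
Proof.
split; first split.
- by rewrite !inE.
- by move=> a u v; rewrite !inE /= => -> ->; rewrite scaler0 addr0.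
- move=> x y /= ->.
  by have := bracket_linearl y (- 1) 0 0; rewrite !scaleN1r oppr0 addr0 addNr.
Qed.

Lemma ideal_upper_extension I :
  ideal I -> ideal (upper_extension I) /\ I `<=` upper_extension I.
Proof.
move=> [[I0 Ilin] Ibr]; rewrite inE in I0.
have IU : I `<=` upper_extension I by move=> x Ix _ [y _ <-]; exact: Ibr.
split=> //; split; first split.
- by rewrite !inE; exact: IU.
- move=> a u v; rewrite !inE => Uu Uv _ [y _ <-].
  have /= -> := bracket_linearl y a u v.
  have := Ilin a (bracket u y) (bracket v y); rewrite !inE; apply.
    by apply: Uu; exists y.
  by apply: Uv; exists y.
- by move=> x y Ux; apply: IU; apply: Ux; exists y.
Qed.

Lemma ideal_upper_central_series k : ideal (upper_central_series k).
Proof.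
by elim: k => [|k IH]; [exact: ideal0 | have [] := ideal_upper_extension IH].
Qed.

Lemma upper_central_length_exists : exists! m, is_upper_central_length m.
Proof.
pose U := upper_central_series.
have US k : U k `<=` U k.+1.
  by have [] := ideal_upper_extension (ideal_upper_central_series k).
have dimU n : (forall k, (k < n)%N -> U k `<` U k.+1) ->
    exists2 V : {vspace L}, (n <= \dim V)%N & forall v, v \in V -> U n v.
  elim: n => [_|n IH lt].
    by exists 0%VS => // v; rewrite memv0 => /eqP ->.
  have [|V nV VU] := IH; first by move=> k kn; apply: lt; rewrite ltnS ltnW.
  have [_ /existsNP[x /not_implyP[Ux nUx]]] := lt n (ltnSn n).
  exists (V + <[x]>)%VS.
    rewrite (leq_ltn_trans nV)// ltn_neqAle dimvS ?addvSl// andbT.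
    apply/negP => /eqP eqd; apply: nUx; apply: VU.
    have /eqP -> : (V == V + <[x]>)%VS by rewrite eqEdim addvSl eqd leqnn.
    by rewrite (subvP (addvSr _ _))// memv_line.
  move=> _ /memv_addP[v Vv [_ /vlineP[a ->] ->]].
  have [[_ Ulin] _] := ideal_upper_central_series n.+1.
  have := Ulin a x v; rewrite !inE addrC; apply; first exact: Ux.
  by apply: US; exact: VU.
have fixP m : upper_bounded_ideal (U m) <-> ~ U m `<` U m.+1.
  split=> [[_ Um] [_]|nlt]; first by apply; rewrite /U /= -/(U m) Um.
  split; first exact: ideal_upper_central_series.
  apply/seteqP; split; last exact: US.
  by apply: contrapT => nsub; apply: nlt.
have ex : exists m, `[< ~ U m `<` U m.+1 >].
  apply: contrapT => /forallNP nex.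
  have [|V] := dimU (\dim {:L}).+1.
    by move=> k _; apply: contrapT => nk; apply: (nex k); apply/asboolP.
  by rewrite ltnNge dimvS ?subvf.
have [m /asboolP Pm minm] := ex_minnP ex.
exists m; split=> [|m' [lt /fixP Pm']].
  split; last exact/fixP.
  move=> k km; apply: contrapT => nk.
  by have := minm k; rewrite leqNgt km => /(_ (asboolT nk)).
apply/eqP; rewrite eqn_leq minm ?asboolT//= leqNgt.
by apply/negP => /lt.
Qed.

End UpperBoundedIdeals.

Arguments upper_central_series {F} L k.
Arguments is_upper_central_length {F} L m.

(* Main.v *)
Require Import Defs.
From mathcomp Require Import all_boot all_order all_algebra.
From mathcomp Require Import boolp classical_sets reals complex.

Local Open Scope classical_set_scope.

(** The upper extension is a monotone operator on subsets of [L], the upper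
    bounded ideals are the ideals among its fixed points, and the upper central
    series is its iteration from [0], which lies in every ideal. As for the
    least fixed point of any monotone operator, every term of the series
    therefore lies in every upper bounded ideal ([upper_central_series_sub]).
    Since [U_m(0)] is itself upper bounded, it is the smallest such ideal, and
    it contains every other term of the series. *)

Lemma upper_extensionS {F : fieldType} {L : lieAlgType F} (I J : set L) :
  I `<=` J -> upper_extension I `<=` upper_extension J.
Proof. by move=> IJ x UIx; exact: subset_trans UIx IJ. Qed.

Lemma upper_central_series_sub {F : fieldType} {L : lieAlgType F} (J : set L)
    (k : nat) :
  upper_bounded_ideal J -> upper_central_series L k `<=` J.
Proof.
move=> [[[J0 _] _] UJ]; elim: k => [|k IHk].
  by move=> _ ->; rewrite inE in J0.
by rewrite -UJ; exact: upper_extensionS.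
Qed.

Theorem proposition4p2 (R : realType) (K : ground_field)
    (L : lieAlgType (scalars R K)) (m : nat)
    (hm : is_upper_central_length L m) :
  smallest_upper_bounded_ideal (upper_central_series L m) /\
  (forall k : nat, upper_central_series L k `<=` upper_central_series L m).
Proof.
have [_ Um] := hm.
split=> [|k]; last exact: upper_central_series_sub.
by split=> // J; exact: upper_central_series_sub.
Qed.
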